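(* Suppose that $[p_1]>[p_2]>\cdots$ is a sequence in $\mathcal{PL}^0$. Then there is $[\underline{p}]\in\mathcal{PL}^0$ such that $[\underline{p}]<[p_j]$ for all $j\in\mathbb{N}$. In particular, for every positive infinitesimal $\delta\in{}^*\mathbb{R}$, the set $\mathcal{N}^0_\delta$ does not have a countable coinitial subset.
   Context: A sufficiently saturated nonstandard extension $X\mapsto{}^*X$ (at least an enlargement) is fixed. $\mathbb{R}_+=(0,\infty)$. $\mathcal{M}$ is the set of germs at $0$ of functions $m:\mathbb{R}_+\to\mathbb{R}_+$ with $\lim_{t\to0}m(t)=0$ and $m(r)<m(t)$ for all sufficiently small $0<r<t$; $\mathcal{M}^0\subset\mathcal{M}$ consists of those germs having a representative continuous for all sufficiently small $t>0$. For such germs, $[m]<[m']$ means $m(t)<m'(t)$ for all sufficiently small $t>0$. $\mathcal{PL}^0\subset\mathcal{M}^0$ is the set of germs $[p]$ such that, for all sufficiently large $j\in\mathbb{N}$, $p(1/j)\in\{1/k:k\in\mathbb{N}\}$ and $p$ is affine on $[1/(j+1),1/j]$. $\mathcal{N}^0_\delta=\{{}^*m(\delta):[m]\in\mathcal{M}^0\}$, totally ordered by the order of ${}^*\mathbb{R}$. A subset $J$ of an ordered set $P$ is coinitial in $P$ if for every $p\in P$ there is $a\in J$ with $a\le p$. *)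

(* Defs.v *)
From mathcomp Require Import all_boot all_order all_algebra.
From mathcomp Require Import all_classical all_reals all_analysis.

Set Implicit Arguments.
Unset Strict Implicit.
Unset Printing Implicit Defensive.

Import Order.TTheory GRing.Theory Num.Theory.
Import numFieldNormedType.Exports.

Local Open Scope classical_set_scope.
Local Open Scope ring_scope.

(** * Nonstandard extensions

    The superstructure over the reals is presented in Robinson's typed form:
    its levels are the sorts generated from R by products and power sets. A
    nonstandard extension interprets every sort and satisfies the transfer
    principle for all first-order formulas over these sorts. Quantifying over
    [spow s] amounts to quantifying over internal subsets of the extension of
    the sort [s], so these formulas are the bounded formulas of the usual
    (untyped) superstructure formulation. *)

Inductive hsort : Type :=
| sreal
| sprod of hsort & hsort
| spow of hsort.

Fixpoint std (R : realType) (s : hsort) : Type :=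
  match s with
  | sreal => R
  | sprod a b => (std R a * std R b)%type
  | spow a => set (std R a)
  end.

(* De Bruijn variables: [var G a] are the positions of the sort [a] in [G]. *)
Inductive var : seq hsort -> hsort -> Type :=
| var0 G a : var (a :: G) a
| varS G a b : var G a -> var (b :: G) a.

(* Every standard object is named by a constant. *)
Inductive term (R : realType) (G : seq hsort) : hsort -> Type :=
| Tvar a of var G a : term R G a
| Tcst a of std R a : term R G a
| Tpair a b of term R G a & term R G b : term R G (sprod a b).

Arguments var0 {G a}.
Arguments Tvar {R G a} x.
Arguments Tcst {R G} a c.

Inductive formula (R : realType) : seq hsort -> Type :=
| Fmem G a of term R G a & term R G (spow a) : formula R G
| Feq G a of term R G a & term R G a : formula R G
| Fnot G of formula R G : formula R G
| Fand G of formula R G & formula R G : formula R G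
| Fall G a of formula R (a :: G) : formula R G.

Record structure (R : realType) := Structure {
  carrier : hsort -> Type;
  pairing : forall a b, carrier a -> carrier b -> carrier (sprod a b);
  member : forall a, carrier a -> carrier (spow a) -> Prop;
  star : forall a, std R a -> carrier a }.

Arguments carrier {R} s a : rename.
Arguments pairing {R} s {a b} x y : rename.
Arguments member {R} s {a} x A : rename.
Arguments star {R} s a x : rename.

Definition standard (R : realType) : structure R :=
  @Structure R (std R) (fun _ _ x y => (x, y)) (fun _ x A => A x)
    (fun _ x => x).

Section Semantics.
Variables (R : realType) (M : structure R).

Fixpoint env (G : seq hsort) : Type :=
  if G is a :: G' then (carrier M a * env G')%type else unit.

Fixpoint lookup G a (x : var G a) : env G -> carrier M a :=
  match x in var G a return env G -> carrier M a with
  | var0 _ _ => fun e => e.1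
  | varS _ _ _ y => fun e => lookup y e.2
  end.

Fixpoint eval G a (t : term R G a) (e : env G) : carrier M a :=
  match t in term _ _ a return carrier M a with
  | Tvar _ x => lookup x e
  | Tcst a c => star M a c
  | Tpair _ _ t u => pairing M (eval t e) (eval u e)
  end.

Fixpoint sat G (f : formula R G) : env G -> Prop :=
  match f in formula _ G return env G -> Prop with
  | Fmem _ _ t u => fun e => member M (eval t e) (eval u e)
  | Feq _ _ t u => fun e => eval t e = eval u e
  | Fnot _ f => fun e => ~ sat f e
  | Fand _ f g => fun e => sat f e /\ sat g e
  | Fall _ a f => fun e => forall x : carrier M a, sat f (x, e)
  end.

End Semantics.

Definition nonstandard_extension (R : realType) (M : structure R) : Prop :=
  forall f : formula R [::], sat (M := standard R) f tt <-> sat (M := M) f tt.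

(* The internal set *A attached to a standard set A of objects of sort [a]. *)
Definition star_set (R : realType) (M : structure R) (a : hsort)
    (A : set (std R a)) : set (carrier M a) :=
  [set x | member M x (star M (spow a) A)].

Arguments star_set {R} M {a} A.

Definition enlargement (R : realType) (M : structure R) : Prop :=
  nonstandard_extension M /\
  forall (a : hsort) (F : set (set (std R a))),
    (forall F' : set (set (std R a)), F' `<=` F -> finite_set F' ->
       (\bigcap_(A in F') A) !=set0) ->
    (\bigcap_(A in F) star_set M A) !=set0.

Section Hyperreals.
Variables (R : realType) (M : structure R).

Definition hyperreal := carrier M sreal.

Definition hlt (x y : hyperreal) : Prop :=
  star_set M (a := sprod sreal sreal) [set z : R * R | z.1 < z.2]
    (pairing M x y).

Definition hle (x y : hyperreal) : Prop :=
  star_set M (a := sprod sreal sreal) [set z : R * R | z.1 <= z.2]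
    (pairing M x y).

Definition positive_infinitesimal (d : hyperreal) : Prop :=
  hlt (star M sreal 0) d /\
  forall e : R, 0 < e -> hlt d (star M sreal e).

(* [star_fun m x y] means *m(x) = y, where *m is the function whose graph is
   the extension of the graph of m restricted to the positive reals. *)
Definition star_fun (m : R -> R) (x y : hyperreal) : Prop :=
  star_set M (a := sprod sreal sreal)
    [set z : R * R | 0 < z.1 /\ z.2 = m z.1] (pairing M x y).

End Hyperreals.

(** * Germs at 0 of functions from the positive reals to themselves

    Such a function is represented by a total function on R; the values at
    nonpositive arguments are forgotten when passing to germs. *)

Section Germs.
Variable R : realType.

Definition positive_fun (m : R -> R) : Prop := forall t, 0 < t -> 0 < m t.

Definition germ (m : R -> R) : set (R -> R) :=
  [set m' | positive_fun m' /\ \forall t \near 0^'+, m' t = m t].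

Definition increasing_near0 (m : R -> R) : Prop :=
  exists2 e : R, 0 < e & forall r t, 0 < r -> r < t -> t < e -> m r < m t.

Definition moduli : set (set (R -> R)) :=
  [set g | exists m : R -> R,
     [/\ g = germ m, positive_fun m, m t @[t --> 0^'+] --> (0 : R)
       & increasing_near0 m]].

Definition moduli0 : set (set (R -> R)) :=
  [set g | moduli g /\
     exists2 m, g m & \forall t \near 0^'+, {for t, continuous m}].

Definition PL0 : set (set (R -> R)) :=
  [set g | moduli0 g /\
     exists2 p, g p & \forall j \near \oo,
       (exists k : nat, p j.+1%:R^-1 = k.+1%:R^-1) /\
       (exists a b : R, forall t, t \in `[j.+2%:R^-1, j.+1%:R^-1] ->
          p t = a * t + b)].

Definition germ_lt (g h : set (R -> R)) : Prop :=
  exists m m', [/\ g m, h m' & \forall t \near 0^'+, m t < m' t].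

Definition Ndelta0 (M : structure R) (d : hyperreal M) : set (hyperreal M) :=
  [set y | exists g m, [/\ moduli0 g, g m & star_fun m d y]].

End Germs.

Definition coinitial (T : Type) (le : T -> T -> Prop) (J P : set T) : Prop :=
  J `<=` P /\ forall p, P p -> exists2 a, J a & le a p.

(* Main.v *)
Require Import Defs.
From mathcomp Require Import all_boot all_order all_algebra.
From mathcomp Require Import all_classical all_reals all_analysis.
From mathcomp Require Import zify.

Set Implicit Arguments.
Unset Strict Implicit.
Unset Printing Implicit Defensive.

Import Order.TTheory GRing.Theory Num.Theory.
Import numFieldNormedType.Exports.

Local Open Scope classical_set_scope.
Local Open Scope ring_scope.

(** Both assertions come from one diagonal construction, [PL0_diagonal]: below
    any countable family of functions [f j] that are positive and increasing
    near 0 there is, in the germ order, an element of PL0. Write [h n] for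
    1/(n+1). The value [h (k n)] is chosen smaller than the values
    [f j (h n.+1)] for all [j <= n], with [k] strictly increasing, and [interp k]
    is the piecewise linear function whose value at [h n] is [h (k n)]. On the
    cell between [h n.+1] and [h n] it is at most its value at the right end,
    hence less than the value of each [f j], [j <= n], at the left end, and so
    less than [f j] on the whole cell as soon as [f j] is increasing there. The
    germ at 0 of [interp k] lies in PL0 because [k] is strictly increasing
    ([interp_PL0]).

    The first assertion is the case where the [f j] represent the given germs.
    For the second one, a countable subset J of the values at [d] is given by a
    countable family [f j]; if [q] lies below this family near 0, then by
    transfer [*q(d)] exists and is strictly below every element of J
    ([star_fun_total], [star_fun_lt]), so J is not coinitial. *)

(** * Piecewise linear interpolation at the points 1/(n+1) *)

Section Interpolation.
Variable R : realType.

Local Notation h := (@harmonic R).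

Lemma lt_harmonic m n : (h m < h n) = (n < m)%N.
Proof. by rewrite /= ltf_pV2 ?posrE ?ltr0n// ltr_nat ltnS. Qed.

Lemma le_harmonic m n : (h m <= h n) = (n <= m)%N.
Proof. by rewrite /= lef_pV2 ?posrE ?ltr0n// ler_nat ltnS. Qed.

(** For [0 < t <= 1] this is the [n] with [h n.+1 < t <= h n]; every [t > 1] is
    put in cell 0, so that the interpolation continues its last affine piece
    there and is increasing on all positive reals. *)
Definition cell (t : R) : nat := (Num.truncn t^-1).-1.

Lemma cell_gt t : 0 < t -> h (cell t).+1 < t.
Proof.
move=> t0; rewrite /= invf_plt ?posrE ?ltr0n//.
apply: lt_le_trans (truncnS_gt _) _.
by rewrite ler_nat /cell; case: (Num.truncn _).
Qed.

Lemma cell_le t : 0 < t -> t <= 1 -> t <= h (cell t).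
Proof.
move=> t0 t1; rewrite /= invf_pge ?posrE ?ltr0n//.
rewrite /cell prednK; last by rewrite truncn_gt0 invf_pge ?posrE// invr1.
by rewrite truncn_le invr_ge0 ltW.
Qed.

Lemma cellE n t : h n.+1 < t -> t <= h n -> cell t = n.
Proof.
move=> nt tn; have t0 : 0 < t by exact: lt_trans (harmonic_gt0 _) nt.
rewrite /cell (_ : Num.truncn _ = n.+1)//; apply: truncn_def.
move: nt tn => /= nt tn.
by rewrite invf_pge ?posrE ?ltr0n// tn /= invf_plt ?posrE ?ltr0n.
Qed.

Lemma cell_le1 t : 0 < t -> (0 < cell t)%N -> t <= 1.
Proof.
move=> t0; rewrite /cell; apply: contraTT; rewrite -ltNge => t1.
have /truncn0Pn -> // : ~~ (1 <= t^-1).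
by rewrite -ltNge invf_plt ?posrE// invr1.
Qed.

Variable k : nat -> nat.

(** The affine function with values [h (k n.+1)] at [h n.+1] and [h (k n)] at
    [h n]. *)
Definition secant n (t : R) : R :=
  h (k n.+1) + (h (k n) - h (k n.+1)) / (h n - h n.+1) * (t - h n.+1).

Definition interp (t : R) : R := secant (cell t) t.

Lemma secant_left n : secant n (h n.+1) = h (k n.+1).
Proof. by rewrite /secant subrr mulr0 addr0. Qed.

Lemma secant_right n : secant n (h n) = h (k n).
Proof.
have hn : h n - h n.+1 != 0 by rewrite subr_eq0 gt_eqF// lt_harmonic.
by rewrite /secant divfK// addrC subrK.
Qed.

Hypothesis k_incr : forall n, (k n < k n.+1)%N.

Lemma le_k m n : (m <= n)%N -> (k m <= k n)%N.
Proof. by apply: (homo_leq leqnn leq_trans) => i; exact: ltnW. Qed.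

Lemma k_ge n : (n <= k n)%N.
Proof. by elim: n => // n IHn; exact: leq_ltn_trans IHn (k_incr n). Qed.

Lemma secant_incr n s t : s < t -> secant n s < secant n t.
Proof.
move=> st; rewrite ltrD2l ltr_pM2l ?ltrD2r//.
by rewrite divr_gt0// subr_gt0 lt_harmonic.
Qed.

(** The point [h n.+1] belongs to cell [n.+1], so [interp] follows the other
    secant there; the two agree at that node, whence the continuity. *)
Lemma interp_secant n t : h n.+1 <= t -> t <= h n -> interp t = secant n t.
Proof.
rewrite le_eqVlt => /predU1P[<- _|nt tn]; last by rewrite /interp (cellE nt).
rewrite /interp (@cellE n.+1) ?lexx ?lt_harmonic//.
by rewrite secant_left secant_right.
Qed.

Lemma interp_harmonic n : interp (h n) = h (k n).
Proof. by rewrite (@interp_secant n) ?lexx ?secant_right// le_harmonic. Qed.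

Lemma interp_gt0 t : 0 < t -> 0 < interp t.
Proof.
move=> t0; apply: lt_trans (harmonic_gt0 (k (cell t).+1)) _.
by rewrite -secant_left secant_incr// cell_gt.
Qed.

Lemma interp_incr s t : 0 < s -> s < t -> interp s < interp t.
Proof.
move=> s0 st; have t0 := lt_trans s0 st.
(* In distinct cells the two values are separated by those at the nodes. *)
have : (cell t <= cell s)%N.
  by rewrite /cell -!subn1 leq_sub2r// le_truncn// lef_pV2 ?posrE ?ltW.
rewrite leq_eqVlt => /predU1P[ts|ts]; first by rewrite /interp ts secant_incr.
have s1 : s <= 1 by apply: cell_le1 => //; exact: leq_ltn_trans ts.
apply: (@le_lt_trans _ _ (h (k (cell s)))).
  by rewrite -secant_right (ltW_homo (@secant_incr _))// cell_le.
apply: (@le_lt_trans _ _ (h (k (cell t).+1))).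
  by rewrite le_harmonic le_k.
by rewrite -secant_left secant_incr// cell_gt.
Qed.

Lemma interp_le n t : 0 < t -> t <= h n -> interp t <= h (k n).
Proof.
move=> t0; rewrite -interp_harmonic le_eqVlt => /predU1P[->//|tn].
exact/ltW/interp_incr.
Qed.

(** The bound is [interp t <= h (k n) <= h n] on cell [n] and below, since a
    strictly increasing [k] satisfies [n <= k n]. *)
Lemma interp_cvg0 : interp t @[t --> 0^'+] --> (0 : R).
Proof.
apply/cvgrPdist_lt => e e0.
have [n _ ne] : \forall n \near \oo, `|0 - h n| < e.
  by have /cvgrPdist_lt := @cvg_harmonic R; exact.
have hn : h n < e.
  by have := ne n (leqnn n); rewrite sub0r normrN ger0_norm ?harmonic_ge0.
near=> t; have t0 : 0 < t by near: t; exact: nbhs_right_gt.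
rewrite sub0r normrN ger0_norm ?ltW ?interp_gt0//.
apply: le_lt_trans hn; apply: (@le_trans _ _ (h (k n))).
  by apply: interp_le => //; near: t; apply: nbhs_right_le; exact: harmonic_gt0.
by rewrite le_harmonic k_ge.
Unshelve. all: by end_near. Qed.

Lemma interp_continuous t : 0 < t -> t < 1 -> {for t, continuous interp}.
Proof.
move=> t0 t1.
have cell_cont n : {within `[h n.+1, h n], continuous interp}.
  apply: (@subspace_eq_continuous _ _ _ (secant n)).
    by move=> s; rewrite inE/= in_itv/= => /andP[nt tn]; exact/esym/interp_secant.
  apply: continuous_subspaceT => s; rewrite /secant.
  apply: cvgD; first exact: cvg_cst.
  apply: cvgM; first exact: cvg_cst.
  by apply: cvgB; [exact: cvg_id|exact: cvg_cst].
(* A node is interior to the union of the two cells that meet there. *)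
have two_cells n : {within `[h n.+2, h n], continuous interp}.
  have -> : `[h n.+2, h n]%classic = `[h n.+2, h n.+1] `|` `[h n.+1, h n].
    have n2 : h n.+2 <= h n.+1 by rewrite le_harmonic.
    have n1 : h n.+1 <= h n by rewrite le_harmonic.
    apply/seteqP; split=> s /=; rewrite !in_itv/=.
      by move=> /andP[-> ->]; rewrite andbT; apply/orP/le_total.
    by move=> [/andP[-> /le_trans->]//|/andP[/(le_trans n2)-> ->]].
  by apply: withinU_continuous => //; exact: itv_closed.
(* The point [t] may be the right end of its cell, so the cell to its right is
   added; in cell 0 the predecessor is 0 and [t < 1] is interior. *)
apply: (@within_continuous_continuous _ _ _ _ _ _ _ _
  (two_cells (cell t).-1)); first by rewrite lt_harmonic.
rewrite in_itv/=; have := cell_gt t0; have := cell_le t0 (ltW t1).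
case: (cell t) => [_ lo|n hi lo] /=.
  by rewrite invr1 t1 andbT; apply: lt_trans lo; rewrite lt_harmonic.
by rewrite lo; apply: le_lt_trans hi _; rewrite lt_harmonic.
Qed.

Lemma germ_interp : germ interp interp.
Proof. by split; [exact: interp_gt0|near=> t]. Unshelve. all: by end_near. Qed.

Lemma interp_PL0 : PL0 (germ interp).
Proof.
split; first split.
- exists interp; split=> //; [exact: interp_gt0|exact: interp_cvg0|].
  by exists 1 => // s t s0 st _; exact: interp_incr.
- exists interp; first exact: germ_interp.
  near=> t; apply: interp_continuous; near: t; first exact: nbhs_right_gt.
  exact: nbhs_right_lt.
- exists interp; first exact: germ_interp.
  near=> n; split; first by exists (k n); exact: interp_harmonic.
  pose s := (h (k n) - h (k n.+1)) / (h n - h n.+1).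
  exists s, (h (k n.+1) - s * h n.+1) => t; rewrite in_itv => /andP[nt tn].
  by rewrite (@interp_secant n)// /secant -/s mulrBr addrCA.
Unshelve. all: by end_near. Qed.

End Interpolation.

(** * Representatives of germs *)

(** A germ in [moduli] is only known to have some increasing representative;
    the diagonalization needs monotonicity for whichever representative is at
    hand, and it carries over on the interval where the two agree. *)
Lemma moduli_rep (R : realType) (g : set (R -> R)) m :
  moduli g -> g m -> positive_fun m /\ increasing_near0 m.
Proof.
move=> [m0 [-> m0_gt0 _ [e e0 m0_incr]]] [m_gt0 mm0]; split=> //.
have : \forall t \near 0^'+, t < e /\ m t = m0 t.
  by near=> t; split; near: t => //; exact: nbhs_right_lt.
move=> [r /= r0 rP]; exists r => // s t s0 st tr.
have near_eq u : 0 < u -> u < r -> u < e /\ m u = m0 u.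
  by move=> u0 ur; apply: rP => //=; rewrite sub0r normrN gtr0_norm.
have [_ ->] := near_eq s s0 (lt_trans st tr).
have [te ->] := near_eq t (lt_trans s0 st) tr.
exact: m0_incr.
Unshelve. all: by end_near. Qed.

(** * Diagonalization *)

Section Diagonalization.
Variable R : realType.

(** As all the [f j] are increasing near 0, it is enough to go below them at
    the points 1/(n+2), and there only below [f 0], ..., [f n], because finitely
    many cells are irrelevant for the germ at 0. *)
Lemma PL0_diagonal (f : nat -> R -> R) :
  (forall j, positive_fun (f j)) -> (forall j, increasing_near0 (f j)) ->
  exists q, [/\ PL0 (germ q), germ q q &
    forall j, \forall t \near 0^'+, q t < f j t].
Proof.
move=> f_gt0 f_incr.
pose c j n := Num.truncn (f j (harmonic n.+1))^-1.
(* Summing the bounds [c j i] over all [j <= i <= n] dominates each of them and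
   makes [k] strictly increasing, thanks to the successors. *)
pose k n := (\sum_(i < n.+1) \sum_(j < i.+1) (c j i).+1)%N.
have k_incr n : (k n < k n.+1)%N.
  rewrite /k [X in (_ < X)%N]big_ord_recr/= [X in (_ + X)%N]big_ord_recr/=.
  lia.
have k_large j n : (j <= n)%N -> harmonic (k n) < f j (harmonic n.+1).
  move=> jn; have fn : 0 < f j (harmonic n.+1).
    by apply: f_gt0; exact: harmonic_gt0.
  rewrite [ltLHS]/= invf_plt ?posrE ?ltr0n//.
  apply: lt_le_trans (truncnS_gt _) _; rewrite ler_nat ltnS -/(c j n).
  have ji : (j < n.+1)%N by [].
  rewrite /k big_ord_recr/= (bigD1 (Ordinal ji))//=; lia.
exists (@interp R k); split; [exact: interp_PL0|exact: germ_interp|move=> j].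
have [e e0 fj] := f_incr j.
near=> t; have t0 : 0 < t by near: t; exact: nbhs_right_gt.
have t1 : t <= 1 by near: t; exact: nbhs_right_le.
have te : t < e by near: t; exact: nbhs_right_lt.
have jt : (j <= cell t)%N.
  rewrite -ltnS -(lt_harmonic R); apply: lt_le_trans (cell_gt t0) _.
  by near: t; apply: nbhs_right_le; exact: harmonic_gt0.
apply: (@le_lt_trans _ _ (harmonic (k (cell t)))).
  by apply: interp_le => //; exact: cell_le.
apply: (lt_trans (k_large _ _ jt)); apply: fj => //; last exact: cell_gt.
exact: harmonic_gt0.
Unshelve. all: by end_near. Qed.

End Diagonalization.

(** * Values at an infinitesimal *)

Section Transfer.
Variables (R : realType) (M : structure R).
Hypothesis M_ext : nonstandard_extension M.

Let lt_set : set (R * R) := [set z | z.1 < z.2].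
Let le_set : set (R * R) := [set z | z.1 <= z.2].
Let graph (m : R -> R) : set (R * R) := [set z | 0 < z.1 /\ z.2 = m z.1].

Let in_rel G (s t : term R G sreal) (A : set (R * R)) : formula R G :=
  Fmem (Tpair s t) (@Tcst R G (spow (sprod sreal sreal)) A).

(** Transfer of: every positive real [x] has some [y] with [y = m x]. *)
Lemma star_fun_total (m : R -> R) (d : hyperreal M) :
  hlt (star M sreal 0) d -> exists y, star_fun m d y.
Proof.
pose f : formula R [::] :=
  Fall (Fnot (Fand (in_rel (@Tcst R [:: sreal] sreal 0) (Tvar var0) lt_set)
    (Fall (Fnot (in_rel (Tvar (varS _ var0)) (Tvar var0) (graph m)))))).
have /M_ext f_sat : sat (M := standard R) f tt.
  by move=> x /= [x0 /(_ (m x))]; apply; split.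
move=> d0; apply/not_existsP => no_value.
by apply: (f_sat d); split.
Qed.

(** Transfer of: if [x < e], [y = q x] and [a = m x], with [x] positive, then
    not [a <= y]. *)
Lemma star_fun_lt (q m : R -> R) (e : R) (d y a : hyperreal M) :
  (forall t, 0 < t -> t < e -> q t < m t) -> hlt d (star M sreal e) ->
  star_fun q d y -> star_fun m d a -> ~ hle a y.
Proof.
move=> qm de qy ma ay.
(* The variables x, y, a of the formula, a being the innermost one. *)
pose x3 : term R [:: sreal; sreal; sreal] sreal := Tvar (varS _ (varS _ var0)).
pose y3 : term R [:: sreal; sreal; sreal] sreal := Tvar (varS _ var0).
pose a3 : term R [:: sreal; sreal; sreal] sreal := Tvar var0.
pose f : formula R [::] :=
  Fall (Fall (Fall (Fnot (Fand
    (Fand (in_rel x3 (Tcst sreal e) lt_set) (in_rel x3 y3 (graph q)))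
    (Fand (in_rel x3 a3 (graph m)) (in_rel a3 y3 le_set)))))).
have /M_ext f_sat : sat (M := standard R) f tt.
  move=> x' y' a' /= [[xe [x0 yE]] [[_ aE] ay']].
  have := qm x' x0 xe; rewrite /= in yE aE ay'.
  by rewrite -yE -aE ltNge ay'.
exact: (f_sat d y a).
Qed.

End Transfer.

(** The interval on which [q] is below [f j] shrinks with [j], but [d] lies in
    the extension of every one of them, being infinitesimal. *)
Lemma Ndelta0_not_countably_coinitial (R : realType) (M : structure R)
    (d : hyperreal M) : nonstandard_extension M -> positive_infinitesimal d ->
  forall J : set (hyperreal M),
    countable J -> ~ coinitial (@hle R M) J (Ndelta0 d).
Proof.
move=> M_ext [d0 d_small] J /countable_injP[idx idx_inj] [JN Jcoinit].
have id_incr : increasing_near0 (id : R -> R) by exists 1.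
(* Enumerate J by functions; indices outside the range of [idx] get [id]. *)
have /choice[f fP] : forall n, exists m : R -> R,
    [/\ positive_fun m, increasing_near0 m &
      forall y, J y -> idx y = n -> star_fun m d y].
  move=> n; have [[y [Jy yn]]|no_y] := pselect (exists y, J y /\ idx y = n).
    have [g [m [[g_mod _] gm my]]] := JN y Jy.
    have [m_gt0 m_incr] := moduli_rep g_mod gm.
    exists m; split=> // z Jz zn.
    by rewrite (_ : z = y)//; apply: idx_inj; rewrite ?inE// zn.
  by exists id; split=> // y Jy yn; case: no_y; exists y.
have [|| q [q_PL0 qq q_lt]] := @PL0_diagonal R f.
- by move=> j; have [] := fP j.
- by move=> j; have [] := fP j.
have [y qy] := star_fun_total M_ext q d0.
have [|a Ja ay] := Jcoinit y.
  by exists (germ q), q; split=> //; case: q_PL0.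
have [_ _ /(_ a Ja erefl) fa] := fP (idx a).
have [e /= e0 q_lt_e] := q_lt (idx a).
apply: (star_fun_lt M_ext _ (d_small e e0) qy fa ay) => t t0 te.
by apply: q_lt_e => //=; rewrite sub0r normrN gtr0_norm.
Qed.

Theorem proposition3p5 (R : realType) :
  (forall p : nat -> set (R -> R),
     (forall j, PL0 (p j)) ->
     (forall j, germ_lt (p j.+1) (p j)) ->
     exists2 q : set (R -> R), PL0 q & forall j, germ_lt q (p j)) /\
  (forall M : structure R, enlargement M ->
     forall d : hyperreal M, positive_infinitesimal d ->
       ~ exists J : set (hyperreal M),
           countable J /\ coinitial (@hle R M) J (Ndelta0 d)).
Proof.
split=> [p p_PL0 _|M [M_ext _] d d_inf [J [J_count J_coinit]]]; last first.
  exact: (Ndelta0_not_countably_coinitial M_ext d_inf J_count J_coinit).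
have /choice[f fP] : forall j, exists m : R -> R,
    [/\ p j m, positive_fun m & increasing_near0 m].
  move=> j; have [[p_mod _] [m pm _]] := p_PL0 j.
  by exists m; have [] := moduli_rep p_mod pm.
have [|| q [q_PL0 qq q_lt]] := @PL0_diagonal R f.
- by move=> j; have [] := fP j.
- by move=> j; have [] := fP j.
exists (germ q) => // j; exists q, (f j); split=> //.
by have [] := fP j.
Qed.
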